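(* For every $n\geq 2$, $(A_n^+)^{\mathrm{ab}}\cong\mathbb{Z}^{2(n-1)}$. Every generating set of $A_n^+$ contains at least $2(n-1)$ elements. The automorphisms \[ d_{2,1},d_{3,2},\ldots,d_{n,n-1},\qquad e_{2,1},e_{3,2},\ldots,e_{n,n-1} \] form a generating set of $A_n^+$ of minimum cardinality.
   Context: Let $F_n$ be the free group of rank $n\geq 2$ with basis $x_1,\ldots,x_n$. For $1\leq j<i\leq n$, let $d_{i,j},e_{i,j}\in\operatorname{Aut}(F_n)$ be the automorphisms with $d_{i,j}(x_i)=x_ix_j$, $e_{i,j}(x_i)=x_jx_i$, and $d_{i,j}(x_k)=e_{i,j}(x_k)=x_k$ for $k\neq i$. Automorphisms are composed as functions: $(\alpha\beta)(x)=\alpha(\beta(x))$. Set $A_n^+=\langle d_{i,j},e_{i,j}\mid 1\leq j<i\leq n\rangle\leq\operatorname{Aut}(F_n)$. For a group $G$, $G^{\mathrm{ab}}=G/G'$ denotes its abelianization. *)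

(* Defs.v *)
From HB Require Import structures.
From mathcomp Require Import all_boot all_order all_algebra.
From mathcomp Require Import all_classical.

Set Implicit Arguments.
Unset Strict Implicit.
Unset Printing Implicit Defensive.

Local Open Scope classical_set_scope.
Local Open Scope quotient_scope.
Local Open Scope group_scope.

Section Generated.
Variable G : groupType.
Implicit Types S H : set G.

Definition is_subgroup H : Prop := group_closed [in H].

Definition generated S : set G := smallest is_subgroup S.

Lemma generated_closed S : is_subgroup (generated S).
Proof.
split; first by apply/mem_set => H [[/set_mem H1 _] _].
move=> x y /set_mem Sx /set_mem Sy; apply/mem_set => H HS.
have [[_ divH] _] := HS.
by apply/set_mem/divH; apply/mem_set; [apply: Sx | apply: Sy].
Qed.

Lemma sub_generated S x : S x -> x \in generated S.
Proof. by move=> Sx; apply: mem_set; exact: sub_gen_smallest Sx. Qed.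

Record generated_group S : Type := GeneratedGroup {
  gg_val : G;
  gg_valP : gg_val \in generated S
}.

HB.instance Definition _ S := [isSub for @gg_val S].
HB.instance Definition _ S := [Choice of generated_group S by <:].
HB.instance Definition _ S :=
  SubChoice_isSubGroup.Build G [in generated S] (generated_group S)
    (generated_closed S).

End Generated.

Section Abelianization.
Variable G : groupType.

Definition derived_subgroup : set G :=
  generated [set z | exists x y : G, z = [~ x, y]].

Definition ab_equiv (x y : G) : bool := x / y \in derived_subgroup.

Lemma derived_conj (x y : G) :
  x \in derived_subgroup -> x ^ y \in derived_subgroup.
Proof.
have D := generated_closed [set z : G | exists x y : G, z = [~ x, y]].
move=> Dx; have ->: x ^ y = x * [~ x, y] by rewrite /commg mulVKg.
apply: (group_closedM (S := [in derived_subgroup]) D) => //.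
by apply: sub_generated; exists x, y.
Qed.

Lemma ab_equiv_is_equiv : equiv_class_of ab_equiv.
Proof.
have D := generated_closed [set z : G | exists x y : G, z = [~ x, y]].
split=> [x|x y|y x z]; rewrite /ab_equiv.
- by rewrite divgg; exact: D.1.
- by apply/idP/idP => /(group_closedV (S := [in derived_subgroup]) D);
    rewrite invgF.
- move=> xy yz; rewrite -(mulgVK y x) -mulgA.
  exact: (group_closedM (S := [in derived_subgroup]) D).
Qed.

Canonical ab_equiv_equiv := EquivRelPack ab_equiv_is_equiv.
Canonical ab_equiv_encModRel := defaultEncModRel ab_equiv.

Definition abelianization := {eq_quot ab_equiv}.

HB.instance Definition _ := EqQuotient.on abelianization.
HB.instance Definition _ := Choice.on abelianization.

Definition ab_one : abelianization := lift_cst abelianization 1.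
Definition ab_mul := lift_op2 abelianization *%g.
Definition ab_inv := lift_op1 abelianization (fun x : G => x^-1).

Canonical pi_ab_one_morph := PiConst ab_one.

Lemma pi_ab_mul : {morph \pi_abelianization : x y / x * y >-> ab_mul x y}.
Proof.
move=> x y; unlock ab_mul; apply/eqP; rewrite piE.
set x' := repr _; set y' := repr _.
have xx' : ab_equiv x x'.
  by have /eqP := reprK (\pi_abelianization x); rewrite piE equiv_sym.
have yy' : ab_equiv y y'.
  by have /eqP := reprK (\pi_abelianization y); rewrite piE equiv_sym.
apply: (@equiv_trans _ ab_equiv_equiv (x * y')); rewrite /= /ab_equiv.
  by have := derived_conj x^-1 yy'; rewrite /conjg !invgM invgK !mulgA.
by rewrite invgM mulgA mulgK.
Qed.
Canonical pi_ab_mul_morph := PiMorph2 pi_ab_mul.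

Lemma pi_ab_inv : {morph \pi_abelianization : x / x^-1 >-> ab_inv x}.
Proof.
move=> x; unlock ab_inv; apply/eqP; rewrite piE.
set x' := repr _.
have x'x : ab_equiv x' x.
  by have /eqP := reprK (\pi_abelianization x); rewrite piE.
by have := derived_conj x x'x; rewrite /= /ab_equiv /conjg invgK mulgVK.
Qed.
Canonical pi_ab_inv_morph := PiMorph1 pi_ab_inv.

Lemma ab_mulA : associative ab_mul.
Proof. by move=> x y z; rewrite -[x]reprK -[y]reprK -[z]reprK !piE mulgA. Qed.

Lemma ab_mul1 : left_id ab_one ab_mul.
Proof. by move=> x; rewrite -[x]reprK !piE mul1g. Qed.

Lemma ab_mulr1 : right_id ab_one ab_mul.
Proof. by move=> x; rewrite -[x]reprK !piE mulg1. Qed.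

Lemma ab_mulV : left_inverse ab_one ab_inv ab_mul.
Proof. by move=> x; rewrite -[x]reprK !piE mulVg. Qed.

Lemma ab_mulrV : right_inverse ab_one ab_inv ab_mul.
Proof. by move=> x; rewrite -[x]reprK !piE mulgV. Qed.

HB.instance Definition _ :=
  isGroup.Build abelianization ab_mulA ab_mul1 ab_mulr1 ab_mulV ab_mulrV.

End Abelianization.

Section Automorphisms.
Variable G : groupType.

Definition is_automorphism (f : G -> G) : Prop :=
  bijective f /\ {morph f : x y / x * y}.

Record automorphism : Type := Automorphism {
  aut_fun :> G -> G;
  aut_asboolP : `[< is_automorphism aut_fun >]
}.

HB.instance Definition _ := [isSub for aut_fun].
HB.instance Definition _ := [Choice of automorphism by <:].

Lemma aut_funP (a : automorphism) : is_automorphism a.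
Proof. exact/asboolP/aut_asboolP. Qed.

Definition mk_aut (f : G -> G) (fP : is_automorphism f) : automorphism :=
  Automorphism (introT (asboolP _) fP).

Lemma aut_ext (a b : automorphism) : a =1 b -> a = b.
Proof. by move=> ab; apply/val_inj/funext. Qed.

Lemma is_aut_id : is_automorphism id.
Proof. by split=> //; exists id. Qed.

Lemma is_aut_comp (a b : automorphism) : is_automorphism (a \o b).
Proof.
have [[a_bij aM] [b_bij bM]] := (aut_funP a, aut_funP b).
by split; [exact: bij_comp | move=> x y /=; rewrite bM aM].
Qed.

Lemma aut_surj (a : automorphism) (y : G) : exists x, a x = y.
Proof. by have [[g _ gK] _] := aut_funP a; exists (g y). Qed.

Definition aut_inv_fun (a : automorphism) (y : G) : G :=
  projT1 (cid (aut_surj a y)).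

Lemma aut_inv_funK (a : automorphism) : cancel (aut_inv_fun a) a.
Proof. by move=> y; rewrite /aut_inv_fun; case: cid. Qed.

Lemma aut_funK (a : automorphism) : cancel a (aut_inv_fun a).
Proof.
have [/bij_inj a_inj _] := aut_funP a.
by move=> x; apply: a_inj; rewrite aut_inv_funK.
Qed.

Lemma is_aut_inv (a : automorphism) : is_automorphism (aut_inv_fun a).
Proof.
have [_ aM] := aut_funP a.
split; first by exists a; [exact: aut_inv_funK | exact: aut_funK].
move=> x y; apply: (can_inj (aut_funK a)).
by rewrite aM !aut_inv_funK.
Qed.

Definition aut_one : automorphism := mk_aut is_aut_id.
Definition aut_mul (a b : automorphism) : automorphism :=
  mk_aut (is_aut_comp a b).
Definition aut_inv (a : automorphism) : automorphism := mk_aut (is_aut_inv a).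

Lemma aut_mulA : associative aut_mul.
Proof. by move=> a b c; apply: aut_ext. Qed.

Lemma aut_mul1 : left_id aut_one aut_mul.
Proof. by move=> a; apply: aut_ext. Qed.

Lemma aut_mulr1 : right_id aut_one aut_mul.
Proof. by move=> a; apply: aut_ext. Qed.

Lemma aut_mulV : left_inverse aut_one aut_inv aut_mul.
Proof. by move=> a; apply: aut_ext => x; exact: aut_funK. Qed.

Lemma aut_mulrV : right_inverse aut_one aut_inv aut_mul.
Proof. by move=> a; apply: aut_ext => x; exact: aut_inv_funK. Qed.

HB.instance Definition _ :=
  isGroup.Build automorphism aut_mulA aut_mul1 aut_mulr1 aut_mulV aut_mulrV.

End Automorphisms.

(* The free group on T is the set of reduced words. The letter (t, false)   *)
(* stands for the generator t and (t, true) for its inverse; its universal  *)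
(* property is fg_liftM, fg_lift_gen and fg_lift_uniq below.                *)

Section FreeGroup.
Variable T : choiceType.
Implicit Types (a b : T * bool) (u v w : seq (T * bool)).

Definition inv_letter a := (a.1, ~~ a.2).

Lemma inv_letterK : involutive inv_letter.
Proof. by case=> t b; rewrite /inv_letter /= negbK. Qed.

Definition reduced w := sorted (fun a b => b != inv_letter a) w.

Record free_group : Type := FreeGroup {
  fg_word : seq (T * bool);
  fg_wordP : reduced fg_word
}.

HB.instance Definition _ := [isSub for fg_word].
HB.instance Definition _ := [Choice of free_group by <:].

Definition push a w :=
  if w is b :: w' then if b == inv_letter a then w' else a :: w else [:: a].

Lemma push_reduced a w : reduced w -> reduced (push a w).
Proof.
case: w => [//|b w] /= bw; case: eqP => [_|/eqP nba]; last by rewrite /= nba.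
exact: path_sorted bw.
Qed.

Lemma pushK a w : reduced w -> push a (push (inv_letter a) w) = w.
Proof.
case: w => [|b w] /=; first by rewrite eqxx.
rewrite inv_letterK; case: eqVneq => [->|ba] /=; last by rewrite eqxx.
by case: w => [//|c w] /= /andP[/negbTE->].
Qed.

(* [mulw u v] is the reduced form of the concatenation of u and v, if v is  *)
(* reduced.                                                                 *)
Definition mulw u v := foldr push v u.

Lemma mulw_reduced u v : reduced v -> reduced (mulw u v).
Proof. by move=> rv; elim: u => //= a u; exact: push_reduced. Qed.

Lemma mulw_push a u v : reduced v -> mulw (push a u) v = push a (mulw u v).
Proof.
move=> rv; case: u => [//|b u] /=; case: eqP => [->|//].
by rewrite pushK //; exact: mulw_reduced.
Qed.

Lemma mulw_assoc u v w : reduced w -> mulw u (mulw v w) = mulw (mulw u v) w.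
Proof. by move=> rw; elim: u => //= a u ->; rewrite mulw_push. Qed.

Lemma mulw_nil u : reduced u -> mulw u [::] = u.
Proof.
elim: u => //= a u IH au; rewrite (IH (path_sorted au)).
by case: u au {IH} => //= b u /andP[/negbTE->].
Qed.

Definition invw u := rev (map inv_letter u).

Lemma invwK : involutive invw.
Proof. by move=> u; rewrite /invw map_rev revK mapK //; exact: inv_letterK. Qed.

Lemma invw_reduced u : reduced u -> reduced (invw u).
Proof.
rewrite /reduced /invw rev_sorted sorted_map; apply: sub_sorted => a b /=.
by apply: contra => /eqP/(can_inj inv_letterK)->; rewrite inv_letterK.
Qed.

Lemma mulwV u w : reduced w -> mulw u (mulw (invw u) w) = w.
Proof.
rewrite /invw; elim: u w => //= a u IH w rw.
rewrite rev_cons -cats1 /mulw foldr_cat -!/(mulw _ _) /= IH ?pushK //.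
exact: push_reduced.
Qed.

Definition fg_one : free_group := @FreeGroup [::] isT.
Definition fg_mul (u v : free_group) : free_group :=
  FreeGroup (mulw_reduced (fg_word u) (fg_wordP v)).
Definition fg_inv (u : free_group) : free_group :=
  FreeGroup (invw_reduced (fg_wordP u)).

Lemma fg_mulA : associative fg_mul.
Proof. by move=> u v w; apply: val_inj; exact: mulw_assoc (fg_wordP w). Qed.

Lemma fg_mul1 : left_id fg_one fg_mul.
Proof. by move=> u; exact: val_inj. Qed.

Lemma fg_mulr1 : right_id fg_one fg_mul.
Proof. by move=> u; apply: val_inj; exact: mulw_nil (fg_wordP u). Qed.

Lemma fg_mulrV : right_inverse fg_one fg_inv fg_mul.
Proof.
move=> u; apply: val_inj => /=.
by rewrite -[invw _]mulw_nil ?mulwV //; exact: invw_reduced (fg_wordP u).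
Qed.

Lemma fg_mulV : left_inverse fg_one fg_inv fg_mul.
Proof.
move=> u; have uVV : fg_inv (fg_inv u) = u.
  by apply: val_inj; exact: invwK.
by rewrite -{2}uVV fg_mulrV.
Qed.

HB.instance Definition _ :=
  isGroup.Build free_group fg_mulA fg_mul1 fg_mulr1 fg_mulV fg_mulrV.

Definition fg_gen (t : T) : free_group := @FreeGroup [:: (t, false)] isT.

Section Lift.
Variables (G : groupType) (f : T -> G).

Definition eval_letter a : G := if a.2 then (f a.1)^-1 else f a.1.
Definition evalw w : G := \prod_(a <- w) eval_letter a.

Definition fg_lift (u : free_group) : G := evalw (fg_word u).

Lemma evalw_push a w : evalw (push a w) = eval_letter a * evalw w.
Proof.
case: w => [|b w] /=; first by rewrite /evalw big_seq1 big_nil mulg1.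
case: eqP => [->|_]; last by rewrite /evalw big_cons.
rewrite /evalw big_cons mulgA -[LHS]mul1g; congr (_ * _).
by case: a => t []; rewrite /eval_letter /= ?mulVg ?mulgV.
Qed.

Lemma fg_liftM : {morph fg_lift : u v / u * v}.
Proof.
move=> [u ru] [v rv]; rewrite /fg_lift /=.
elim: u {ru} => [|a u IH] /=; first by rewrite /evalw big_nil mul1g.
by rewrite evalw_push IH /evalw big_cons mulgA.
Qed.

Lemma fg_lift1 : fg_lift 1 = 1.
Proof. exact: big_nil. Qed.

Lemma fg_liftV (u : free_group) : fg_lift u^-1 = (fg_lift u)^-1.
Proof.
by apply: (@mulgI G (fg_lift u)); rewrite -fg_liftM !mulgV fg_lift1.
Qed.

Lemma fg_lift_gen t : fg_lift (fg_gen t) = f t.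
Proof. by rewrite /fg_lift /evalw big_seq1. Qed.

End Lift.

Lemma fg_lift_uniq (G : groupType) (g h : free_group -> G) :
    {morph g : u v / u * v} -> {morph h : u v / u * v} ->
  (forall t, g (fg_gen t) = h (fg_gen t)) -> g =1 h.
Proof.
move=> gM hM gh [w rw].
have morph1 (k : free_group -> G) : {morph k : u v / u * v} -> k 1 = 1 :> G.
  by move=> kM; apply: (@mulgI G (k 1)); rewrite -kM !mulg1.
elim: w rw => [|a w IH] rw.
  have ->: FreeGroup rw = 1 by apply: val_inj.
  by rewrite !morph1.
have rw' := path_sorted rw.
pose x : free_group := @FreeGroup [:: a] isT.
have ->: FreeGroup rw = x * FreeGroup rw'.
  apply: val_inj => /=.
  by case: w rw {IH rw'} => //= b w /andP[/negbTE->].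
rewrite gM hM IH; congr (_ * _).
case: a @x {IH rw rw'} => t [] x; last first.
  by have ->: x = fg_gen t by apply: val_inj.
have xV : x * fg_gen t = 1 by apply: val_inj; rewrite /= eqxx.
by apply: (mulIg (g (fg_gen t))); rewrite {2}gh -gM -hM xV !morph1.
Qed.

End FreeGroup.

(* Indices are shifted by one: 'I_n is {0, ..., n-1}, so the basis element  *)
(* x_i of the free group of rank n is the generator of index i-1.           *)

Section Transvections.
Variable n : nat.

Notation F := (free_group 'I_n).
Notation x := (@fg_gen 'I_n).

Definition d_fun (i j : 'I_n) : F -> F :=
  fg_lift (fun k => if k == i then x i * x j else x k).

Definition e_fun (i j : 'I_n) : F -> F :=
  fg_lift (fun k => if k == i then x j * x i else x k).

Lemma d_fun_aut (i j : 'I_n) : (j < i)%N -> is_automorphism (d_fun i j).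
Proof.
move=> ji; have nji : (j == i) = false by rewrite -val_eqE /= ltn_eqF.
pose g := fg_lift (fun k => if k == i then x i * (x j)^-1 else x k).
split; last exact: fg_liftM.
exists g.
  apply: (fg_lift_uniq (g := g \o d_fun i j)) => [u v|//|k] /=.
    by rewrite /g /d_fun /e_fun !fg_liftM.
  rewrite /d_fun /g fg_lift_gen; case: (eqVneq k i) => [->|/negbTE nki].
    by rewrite fg_liftM !fg_lift_gen eqxx nji mulgVK.
  by rewrite fg_lift_gen nki.
apply: (fg_lift_uniq (g := d_fun i j \o g)) => [u v|//|k] /=.
  by rewrite /g /d_fun /e_fun !fg_liftM.
rewrite /d_fun /g fg_lift_gen; case: (eqVneq k i) => [->|/negbTE nki].
  by rewrite fg_liftM fg_liftV !fg_lift_gen eqxx nji mulgK.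
by rewrite fg_lift_gen nki.
Qed.

Lemma e_fun_aut (i j : 'I_n) : (j < i)%N -> is_automorphism (e_fun i j).
Proof.
move=> ji; have nji : (j == i) = false by rewrite -val_eqE /= ltn_eqF.
pose g := fg_lift (fun k => if k == i then (x j)^-1 * x i else x k).
split; last exact: fg_liftM.
exists g.
  apply: (fg_lift_uniq (g := g \o e_fun i j)) => [u v|//|k] /=.
    by rewrite /g /d_fun /e_fun !fg_liftM.
  rewrite /e_fun /g fg_lift_gen; case: (eqVneq k i) => [->|/negbTE nki].
    by rewrite fg_liftM !fg_lift_gen eqxx nji mulVKg.
  by rewrite fg_lift_gen nki.
apply: (fg_lift_uniq (g := e_fun i j \o g)) => [u v|//|k] /=.
  by rewrite /g /d_fun /e_fun !fg_liftM.
rewrite /e_fun /g fg_lift_gen; case: (eqVneq k i) => [->|/negbTE nki].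
  by rewrite fg_liftM fg_liftV !fg_lift_gen eqxx nji mulKg.
by rewrite fg_lift_gen nki.
Qed.

Definition d_aut (i j : 'I_n) (ji : (j < i)%N) : automorphism F :=
  mk_aut (d_fun_aut ji).

Definition e_aut (i j : 'I_n) (ji : (j < i)%N) : automorphism F :=
  mk_aut (e_fun_aut ji).

Definition de_set : set (automorphism F) :=
  [set a | exists (i j : 'I_n) (ji : (j < i)%N), a = d_aut ji \/ a = e_aut ji].

Definition A_plus : set (automorphism F) := generated de_set.
Definition A_plus_group : groupType := generated_group de_set.

Definition consecutive_de_set : set (automorphism F) :=
  [set a | exists (i j : 'I_n) (ji : (j < i)%N),
     i = j.+1 :> nat /\ (a = d_aut ji \/ a = e_aut ji)].

Definition generates_A_plus (S : set (automorphism F)) : Prop :=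
  generated S = A_plus.

End Transvections.

(* Main.v *)
From HB Require Import structures.
Require Import Defs.
From mathcomp Require Import all_boot all_order all_algebra.
From mathcomp Require Import all_classical.
From mathcomp Require Import zify ring.

Set Implicit Arguments.
Unset Strict Implicit.
Unset Printing Implicit Defensive.

(** An element phi of A_n^+ sends x_i to u x_i v with u and v in the subgroup
    generated by x_1, ..., x_(i-1).  The exponent sums of x_(i-1) in u and in v
    are additive in phi, because phi preserves the exponent of x_(i-1) on words
    in x_1, ..., x_(i-1).  For i = 2, ..., n they give 2(n-1) additive maps
    A_n^+ -> Z, under which the automorphisms e_(i,i-1) and d_(i,i-1) are sent
    to the standard basis of Z^(2(n-1)) ([coordinates_step_gen]).

    To read off these exponents from the element phi(x_i) alone, and so avoid
    the uniqueness of u and v, the free group is mapped to the integral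
    Heisenberg group, with x_(i-1) and x_i going to its two standard generators
    and all other basis elements to 1.  The central coordinate of the image of
    a word counts, with signs, the occurrences of the first letter that come
    before one of the second.  On u x_i v it equals the exponent of x_(i-1)
    in u or in v, according to the order chosen for the two letters.  Additivity
    ([pair_count_additive_lo_hi], [pair_count_additive_hi_lo]) has to be checked
    only for right multiplication by a generator, and there it follows from the
    unitriangularity of A_n^+ ([A_plus_unitriangular]): phi fixes x_i modulo
    the normal closure of x_1, ..., x_(i-1).

    Conversely the consecutive automorphisms generate A_n^+
    ([consecutive_generates]), because d_(i,j) is the commutator
    d_(i,k)^-1 d_(k,j) d_(i,k) d_(k,j)^-1 whenever j < k < i, and likewise
    for e.  A group generated by m
    elements that some homomorphism sends to the standard basis of Z^m has
    abelianization Z^m ([abelianization_free]): the basis can be sent back to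
    the classes of the generators, as the abelianization is commutative.  A
    generating set needs at least m elements because its image must span Q^m
    ([card_generators]). *)

Import GRing.Theory.
Local Open Scope classical_set_scope.
Local Open Scope quotient_scope.
Local Open Scope group_scope.

(** * Generated subgroups *)

Section GeneratedTheory.
Variables (G : groupType) (S : set G).

Lemma generated1 : generated S 1.
Proof. exact: (set_mem (generated_closed S).1). Qed.

Lemma generated_div x y :
  generated S x -> generated S y -> generated S (x / y).
Proof.
move=> Sx Sy; apply/set_mem.
by apply: (generated_closed S).2; apply/mem_set.
Qed.

Lemma generatedV x : generated S x -> generated S x^-1.
Proof.
by move=> Sx; rewrite -[x^-1]div1g; apply: generated_div => //; exact: generated1.
Qed.

Lemma generatedM x y :
  generated S x -> generated S y -> generated S (x * y).
Proof.
by move=> Sx Sy; rewrite -[y]invgK; apply: generated_div => //; exact: generatedV.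
Qed.

Lemma generated_gen x : S x -> generated S x.
Proof. by move=> Sx; exact/set_mem/sub_generated. Qed.

Lemma generated_ind (P : set G) : P 1 -> (forall x, S x -> P x) ->
    (forall x y, generated S x -> generated S y -> P x -> P y -> P (x / y)) ->
  forall x, generated S x -> P x.
Proof.
move=> P1 PS Pdiv x Sx.
suff: generated S `<=` [set x | generated S x /\ P x] by move=> /(_ x Sx)[].
apply: smallest_sub => [|y Sy]; last by split; [exact: generated_gen|exact: PS].
split; first by apply/mem_set; split=> //; exact: generated1.
move=> y z /set_mem[Sy Py] /set_mem[Sz Pz]; apply/mem_set.
by split; [exact: generated_div|exact: Pdiv].
Qed.

End GeneratedTheory.

Lemma generated_sub (G : groupType) (S T : set G) :
  S `<=` generated T -> generated S `<=` generated T.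
Proof.
move=> ST x; apply: (generated_ind (P := generated T)) => [|//|y z _ _].
  exact: generated1.
exact: generated_div.
Qed.

(** Elements that generate a subgroup inside the ambient group also generate it
    as a group of its own; this transports generators of A_n^+ to the type whose
    abelianization is formed. *)
Lemma generated_group_generated (G : groupType) (S T : set G) :
    generated T = generated S ->
  forall x : generated_group S, generated (@gg_val G S @^-1` T) x.
Proof.
move=> TS x; set T' := _ @^-1` T.
suff: generated T `<=` [set @gg_val G S y | y in generated T'].
  have: generated T (gg_val x) by rewrite TS; exact/set_mem/gg_valP.
  by move=> Tx /(_ _ Tx)[y T'y /val_inj <-].
apply: generated_ind => [|y Ty|_ _ _ _ [y T'y <-] [z T'z <-]].
- by exists 1; first exact: generated1.
- have Sy : y \in generated S by apply/mem_set; rewrite -TS; exact: generated_gen.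
  by exists (GeneratedGroup Sy); first exact: generated_gen.
- by exists (y / z); first exact: generated_div.
Qed.

(** * Additive maps on a generated subgroup *)

(** The coordinate maps below are defined on all of Aut(F_n) but are
    homomorphisms only on A_n^+, hence the relative notion. *)
Definition additive_on (G : groupType) (V : zmodType) (S : set G) (L : G -> V) :=
  forall x y, generated S x -> generated S y -> L (x * y) = (L x + L y)%R.

Section AdditiveOn.
Variables (G : groupType) (V : zmodType) (S : set G) (L : G -> V).

(** Right multiplication by a fixed y translates L by L y; the elements y with
    this property form a subgroup, so it is enough to test the generators. *)
Lemma additive_on_gen : L 1 = 0%R ->
    (forall x y, generated S x -> S y -> L (x * y) = (L x + L y)%R) ->
  additive_on S L.
Proof.
move=> L1 LS x y Sx Sy; move: y Sy x Sx.
pose P := [set y | forall x, generated S x -> L (x * y) = (L x + L y)%R].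
apply: (generated_ind (P := P)) => [x _|y Sy x Sx|y z Sy Sz Py Pz].
- by rewrite mulg1 L1 addr0.
- exact: LS.
have PzV x : generated S x -> L (x / z) = (L x - L z)%R.
  by move=> Sx; have := Pz _ (generated_div Sx Sz); rewrite mulgVK => ->;
    rewrite addrK.
move=> x Sx; rewrite mulgA (PzV _ (generatedM Sx Sy)) (PzV _ Sy).
by rewrite (Py _ Sx) addrA.
Qed.

Hypothesis LM : additive_on S L.

Lemma additive_on1 : L 1 = 0%R.
Proof.
apply: (addrI (L 1)); rewrite addr0 -LM ?mulg1 //; exact: generated1.
Qed.

Lemma additive_on_div x y : generated S x -> generated S y ->
  L (x / y) = (L x - L y)%R.
Proof.
by move=> Sx Sy; have := LM (generated_div Sx Sy) Sy; rewrite mulgVK => ->;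
  rewrite addrK.
Qed.

End AdditiveOn.

Lemma additive_on_eq (G : groupType) (V : zmodType) (S : set G) (L M : G -> V) :
    additive_on S L -> additive_on S M -> (forall x, S x -> L x = M x) ->
  forall x, generated S x -> L x = M x.
Proof.
move=> LA MA LM; apply: generated_ind => [|//|x y Sx Sy Lx Ly].
  by rewrite (additive_on1 LA) (additive_on1 MA).
by rewrite (additive_on_div LA Sx Sy) (additive_on_div MA Sx Sy) Lx Ly.
Qed.

(** * Rank lower bound *)

(** A finite S of cardinal k gives k rows in Q^m; they span every value of L
    on the subgroup, in particular the standard basis, so m <= k. *)
Lemma card_generators (G : groupType) (m : nat) (S : set G)
    (L : G -> 'rV[int]_m) :
    additive_on S L ->
    (forall k, exists2 x, generated S x & L x = delta_mx 0%R k) ->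
  (`I_m #<= S)%card.
Proof.
move=> LM Lsurj.
have [fS|/infiniteP] := pselect (finite_set S); last first.
  by apply: card_le_trans; exact: subset_card_le.
have [k Sk] := (finite_setP S).1 fS.
rewrite (card_le_eqr Sk) card_le_II.
have [c [cS cI cE]] := card_set_bijP Sk.
have g_ex (i : 'I_k) : exists x, S x /\ c x = i.
  by have [x Sx cx] := cE i (ltn_ord i); exists x.
(* The rows of M are the values of L on S, numbered by the bijection c. *)
pose M : 'M[rat]_(k, m) :=
  (\matrix_(i < k) map_mx intr (L (projT1 (cid (g_ex i)))))%R.
have LS x : generated S x -> (map_mx intr (L x) <= M)%MS.
  move: x; apply: generated_ind => [|x Sx|x y Sx Sy Mx My].
  - by rewrite (additive_on1 LM) map_mx0 sub0mx.
  - have ck : (c x < k)%N by exact: cS.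
    suff -> : map_mx intr (L x) = row (Ordinal ck) M by exact: row_sub.
    rewrite rowK; case: cid => y [Sy /= cy]; congr (map_mx _ (L _)).
    by apply: cI; rewrite ?inE // cy.
  - by rewrite (additive_on_div LM) // map_mxB addmx_sub // eqmx_opp.
suff /eqP <- : row_full M by exact: rank_leq_row.
rewrite -sub1mx; apply/row_subP => i; rewrite row1.
have [x Sx Lx] := Lsurj i.
by have := LS x Sx; rewrite Lx map_delta_mx.
Qed.

(** * Abelianizations that are free of finite rank *)

Section FreeAbelianization.
Variable G : groupType.

Lemma ab_mulC : commutative (@ab_mul G).
Proof.
move=> x y; rewrite -[x]reprK -[y]reprK !piE; apply/eqP; rewrite piE /=.
apply: sub_generated; exists (repr x)^-1, (repr y)^-1.
by rewrite /commg /conjg !invgK invgM !mulgA.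
Qed.

(** The abelianization in additive notation, so that finite sums and integer
    multiples of classes are available. *)
Definition ab_zmodule : Type := abelianization G.
HB.instance Definition _ := Choice.on ab_zmodule.
HB.instance Definition _ := GRing.isZmodule.Build ab_zmodule
  (@ab_mulA G) ab_mulC (@ab_mul1 G) (@ab_mulV G).

Definition ab_class (x : G) : ab_zmodule := \pi_(abelianization G) x.

Lemma ab_classM (x y : G) : ab_class (x * y) = (ab_class x + ab_class y)%R.
Proof. by rewrite /ab_class pi_ab_mul. Qed.

(** A homomorphism to an abelian group kills commutators, so it factors through
    the abelianization. *)
Lemma additive_ab_class (V : zmodType) (L : G -> V) :
  {morph L : x y / x * y >-> (x + y)%R} ->
  forall x y : G, ab_class x = ab_class y -> L x = L y.
Proof.
move=> LM x y /eqP; rewrite /ab_class piE /= => /set_mem.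
have LA : additive_on setT L by move=> u v _ _; exact: LM.
have G_gen u : generated [set: G] u by exact: generated_gen.
have LB u v : L (u / v) = (L u - L v)%R by exact: additive_on_div LA _ _ _ _.
have L1 := additive_on1 LA.
suff L0 z : derived_subgroup z -> L z = 0%R.
  by move=> /L0; rewrite LB => /eqP; rewrite subr_eq0 => /eqP.
move: z; apply: generated_ind => [//|_ [u [v ->]]|u v _ _ Lu Lv].
  have LV u' : L u'^-1 = (- L u')%R by rewrite -div1g LB L1 sub0r.
  by rewrite /commg /conjg !LM !LV addrA addrACA addNr add0r addNr.
by rewrite LB Lu Lv subrr.
Qed.

(** The map induced by L is inverted by the map sending the k-th basis vector to
    the class of t k: both composites are additive and fix generators. *)
Lemma abelianization_free (m : nat) (L : G -> 'rV[int]_m) (t : 'I_m -> G) :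
    {morph L : x y / x * y >-> (x + y)%R} ->
    (forall k, L (t k) = delta_mx 0%R k) ->
    (forall x, generated (range t) x) ->
  exists f : abelianization G -> 'rV[int]_m,
    bijective f /\ {morph f : x y / x * y >-> (x + y)%R}.
Proof.
move=> LM Lt t_gen.
pose f (a : ab_zmodule) := L (repr a).
have fE x : f (ab_class x) = L x.
  by apply: (additive_ab_class LM); rewrite /ab_class reprK.
have classE (a : ab_zmodule) : a = ab_class (repr a) by rewrite /ab_class reprK.
have fD : {morph f : a b / (a + b)%R}.
  by move=> a b; rewrite [a]classE [b]classE -ab_classM !fE LM.
pose s (v : 'rV[int]_m) : ab_zmodule := (\sum_k ab_class (t k) *~ v 0 k)%R.
have sD : {morph s : u v / (u + v)%R}.
  move=> u v; rewrite /s -big_split; apply: eq_bigr => k _ /=.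
  by rewrite mxE mulrzDr.
have fB : GRing.zmod_morphism f.
  by move=> u v; apply: (addIr (f v)); rewrite -fD !subrK.
pose fA : {additive _ -> _} := HB.pack f (GRing.isZmodMorphism.Build _ _ f fB).
have sL x : s (L x) = ab_class x.
  move: x (t_gen x); apply: additive_on_eq => [x y _ _|x y _ _|_ [k _ <-]].
  - by rewrite LM sD.
  - exact: ab_classM.
  - rewrite Lt /s (bigD1 k) //= mxE !eqxx mulr1z big1 ?addr0 // => i /negbTE ik.
    by rewrite mxE ik andbF mulr0z.
exists f; split; last exact: fD.
exists s => [a|v]; first by rewrite {1}[a]classE fE sL -classE.
rewrite -[LHS]/(fA _) /s raddf_sum [RHS]row_sum_delta; apply: eq_bigr => k _.
by rewrite raddfMz /= fE Lt -scaler_int intz.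
Qed.

End FreeAbelianization.

(** * Unitriangularity of the elements of A_n^+ *)

Lemma autM (G : groupType) (a : automorphism G) : {morph a : x y / x * y}.
Proof. exact: (aut_funP a).2. Qed.

Lemma aut_eq_gen (T : choiceType) (a b : automorphism (free_group T)) :
  (forall t, a (fg_gen t) = b (fg_gen t)) -> a = b.
Proof.
by move=> ab; apply: aut_ext; apply: fg_lift_uniq ab; exact: autM.
Qed.

Section Unitriangular.
Variable n : nat.
Notation F := (free_group 'I_n).
Notation x := (@fg_gen 'I_n).

Lemma d_autE (i j : 'I_n) (ji : (j < i)%N) k :
  d_aut ji (x k) = if k == i then x i * x j else x k.
Proof. exact: fg_lift_gen. Qed.

Lemma e_autE (i j : 'I_n) (ji : (j < i)%N) k :
  e_aut ji (x k) = if k == i then x j * x i else x k.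
Proof. exact: fg_lift_gen. Qed.

(** The element a fixes x_k modulo the normal closure of the smaller basis
    elements.  This congruence is tested against an arbitrary homomorphism h
    that kills x_0, ..., x_(m-1): quantifying over h makes the property stable
    under composition, since h \o a again kills these elements. *)
Lemma A_plus_unitriangular (a : automorphism F) : A_plus a ->
  forall (G : groupType) (h : F -> G) (m : nat),
    {morph h : u v / u * v} -> (forall k : 'I_n, (k < m)%N -> h (x k) = 1) ->
  forall k : 'I_n, (k <= m)%N -> h (a (x k)) = h (x k).
Proof.
move=> Aa G; move: a Aa.
apply: generated_ind => [//|_ [i [j [ji [->|->]]]] h m hM h1 k km|].
- rewrite d_autE; case: eqP => // ki; subst k.
  by rewrite hM [h (x j)]h1 ?mulg1 // (leq_trans ji).
- rewrite e_autE; case: eqP => // ki; subst k.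
  by rewrite hM [h (x j)]h1 ?mul1g // (leq_trans ji).
move=> a b _ _ aP bP h m hM h1.
have haM : {morph h \o a : u v / u * v} by move=> u v /=; rewrite autM hM.
have ha1 (k : 'I_n) : (k < m)%N -> (h \o a) (x k) = 1.
  by move=> km; rewrite /= (aP h m) ?h1 // ltnW.
(* The value of q at x_l is found from that of q at b(x_l), which is h(a(x_l));
   the property of b applies to q once q is known to kill the x_i with i < l. *)
pose q := h \o (a / b).
have qM : {morph q : u v / u * v} by move=> u v; rewrite /q /comp autM hM.
have qb u : q (b u) = h (a u) by rewrite /q -[in RHS](mulgVK b a).
move=> k km; rewrite -[LHS]/(q (x k)); move: q qM qb => q qM qb.
move: k km; suff qE l : (l <= m.+1)%N ->
    forall k : 'I_n, (k < l)%N -> q (x k) = h (x k) by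
  move=> k km; exact: (qE m.+1).
elim: l => [//|l IH] lm k kl.
rewrite -(bP q l qM) => [|i il|//].
  by rewrite qb (aP h m hM h1 k (leq_trans kl lm)).
by rewrite (IH (ltnW lm)) // h1 // (leq_trans il lm).
Qed.

(** * Consecutive generators *)

(** Conjugating d_(i,k), which appends x_k to x_i, by d_(k,j), which turns x_k
    into x_k x_j, appends x_k x_j to x_i. *)
Lemma d_relation (i k j : 'I_n) (ji : (j < i)%N) (ki : (k < i)%N) (jk : (j < k)%N) :
  d_aut jk * d_aut ki = d_aut ki * d_aut ji * d_aut jk.
Proof.
have [jk' ik' ij'] : [/\ (j == k) = false, (i == k) = false & (j == i) = false].
  by split; apply/eqP => /(congr1 val) /=; lia.
have ki' : (k == i) = false by rewrite eq_sym.
apply: aut_eq_gen => l.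
rewrite -[LHS]/(d_aut jk (d_aut ki (x l))).
rewrite -[RHS]/(d_aut ki (d_aut ji (d_aut jk (x l)))) !d_autE.
case: (eqVneq l i) => [->|/negbTE li].
  by rewrite ik' !(autM, d_autE, eqxx, ik', ij', jk') mulgA.
case: (eqVneq l k) => [->|/negbTE lk].
  by rewrite !(autM, d_autE, eqxx, ki', ij').
by rewrite !(d_autE, li, lk).
Qed.

Lemma e_relation (i k j : 'I_n) (ji : (j < i)%N) (ki : (k < i)%N) (jk : (j < k)%N) :
  e_aut jk * e_aut ki = e_aut ki * e_aut ji * e_aut jk.
Proof.
have [jk' ik' ij'] : [/\ (j == k) = false, (i == k) = false & (j == i) = false].
  by split; apply/eqP => /(congr1 val) /=; lia.
have ki' : (k == i) = false by rewrite eq_sym.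
apply: aut_eq_gen => l.
rewrite -[LHS]/(e_aut jk (e_aut ki (x l))).
rewrite -[RHS]/(e_aut ki (e_aut ji (e_aut jk (x l)))) !e_autE.
case: (eqVneq l i) => [->|/negbTE li].
  by rewrite ik' !(autM, e_autE, eqxx, ik', ij', jk') mulgA.
case: (eqVneq l k) => [->|/negbTE lk].
  by rewrite !(autM, e_autE, eqxx, ki', ij').
by rewrite !(e_autE, li, lk).
Qed.

(** Induction on i: the relations above with k = i - 1 express d_(i,j) and
    e_(i,j) by consecutive generators and generators with first index i - 1. *)
Lemma consecutive_generates : generates_A_plus (@consecutive_de_set n).
Proof.
rewrite /generates_A_plus; apply/seteqP; split; apply: generated_sub.
  by move=> a [i [j [ji [_ aP]]]]; apply: generated_gen; exists i, j, ji.
have all_gen m : forall (i j : 'I_n) (ji : (j < i)%N), (i < m)%N ->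
    generated (@consecutive_de_set n) (d_aut ji) /\
    generated (@consecutive_de_set n) (e_aut ji).
  elim: m => // m IH i j ji im.
  have kn : (i.-1 < n)%N by exact: leq_ltn_trans (leq_pred i) (ltn_ord i).
  have ki : (Ordinal kn < i)%N by rewrite /=; lia.
  have [dk ek] : generated (@consecutive_de_set n) (d_aut ki) /\
                 generated (@consecutive_de_set n) (e_aut ki).
    by split; apply: generated_gen; exists i, (Ordinal kn), ki;
      (split; [rewrite /=; lia|]); [left|right].
  have [ij|ij] := eqVneq (i : nat) j.+1.
    by split; apply: generated_gen; exists i, j, ji; split => //; [left|right].
  have jk : (j < Ordinal kn)%N by rewrite /=; lia.
  have [djk ejk] := IH _ _ jk ltac:(rewrite /=; lia).
  have -> : d_aut ji = (d_aut ki)^-1 * (d_aut jk * d_aut ki / d_aut jk).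
    by rewrite (d_relation ji ki jk) mulgK mulKg.
  have -> : e_aut ji = (e_aut ki)^-1 * (e_aut jk * e_aut ki / e_aut jk).
    by rewrite (e_relation ji ki jk) mulgK mulKg.
  split.
    exact: generatedM (generatedV dk) (generated_div (generatedM djk dk) djk).
  exact: generatedM (generatedV ek) (generated_div (generatedM ejk ek) ejk).
by move=> _ [i [j [ji [->|->]]]]; have [] := all_gen n i j ji (ltn_ord i).
Qed.

End Unitriangular.

(** * Counting ordered pairs of letters *)

Section Heisenberg.

(** The integral Heisenberg group: (p, q, r) stands for the unitriangular 3 x 3
    matrix with p and q above the diagonal and r in the corner. *)
Definition heis : Type := int * int * int.
HB.instance Definition _ := Choice.on heis.

Definition heis_one : heis := (0, 0, 0)%R.
Definition heis_mul (u v : heis) : heis :=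
  (u.1.1 + v.1.1, u.1.2 + v.1.2, u.2 + v.2 + u.1.1 * v.1.2)%R.
Definition heis_inv (u : heis) : heis :=
  (- u.1.1, - u.1.2, u.1.1 * u.1.2 - u.2)%R.

Lemma heis_mulA : associative heis_mul.
Proof.
move=> [[a b] c] [[a' b'] c'] [[a'' b''] c'']; rewrite /heis_mul /=.
by congr (_, _, _); ring.
Qed.

Lemma heis_mul1 : left_id heis_one heis_mul.
Proof. by move=> [[a b] c]; rewrite /heis_mul /=; congr (_, _, _); ring. Qed.

Lemma heis_mulr1 : right_id heis_one heis_mul.
Proof. by move=> [[a b] c]; rewrite /heis_mul /=; congr (_, _, _); ring. Qed.

Lemma heis_mulV : left_inverse heis_one heis_inv heis_mul.
Proof. by move=> [[a b] c]; rewrite /heis_mul /=; congr (_, _, _); ring. Qed.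

Lemma heis_mulrV : right_inverse heis_one heis_inv heis_mul.
Proof. by move=> [[a b] c]; rewrite /heis_mul /=; congr (_, _, _); ring. Qed.

HB.instance Definition _ :=
  isGroup.Build heis heis_mulA heis_mul1 heis_mulr1 heis_mulV heis_mulrV.

Lemma heis_mulE (u v : heis) : u * v =
  (u.1.1 + v.1.1, u.1.2 + v.1.2, u.2 + v.2 + u.1.1 * v.1.2)%R.
Proof. by []. Qed.

(** These two projections have values in [heis] itself, which makes the exponent
    sum of a single letter a homomorphism to a group already at hand. *)
Definition heis_fst (u : heis) : heis := (u.1.1, 0, 0)%R.
Definition heis_snd (u : heis) : heis := (0, u.1.2, 0)%R.

Lemma heis_fstM : {morph heis_fst : u v / u * v}.
Proof. by move=> u v; rewrite /heis_fst !heis_mulE /=; congr (_, _, _); ring. Qed.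

Lemma heis_sndM : {morph heis_snd : u v / u * v}.
Proof. by move=> u v; rewrite /heis_snd !heis_mulE /=; congr (_, _, _); ring. Qed.

End Heisenberg.

Section PairCount.
Variable n : nat.
Notation F := (free_group 'I_n).
Notation x := (@fg_gen 'I_n).

Definition heis_lift (a b : 'I_n) : F -> heis :=
  @fg_lift _ heis (fun k => if k == a then (1, 0, 0)%R
                            else if k == b then (0, 1, 0)%R else heis_one).

Lemma heis_liftM a b : {morph heis_lift a b : u v / u * v}.
Proof. exact: fg_liftM. Qed.

Lemma heis_lift_gen a b k : heis_lift a b (x k) =
  if k == a then (1, 0, 0)%R else if k == b then (0, 1, 0)%R else heis_one.
Proof. exact: fg_lift_gen. Qed.

(** The signed number of pairs formed by a letter a and a later letter b. *)
Definition pair_count (a b : 'I_n) (w : F) : int := (heis_lift a b w).2.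

Lemma pair_count_gen a b k : pair_count a b (x k) = 0%R.
Proof. by rewrite /pair_count heis_lift_gen; case: ifP => // _; case: ifP. Qed.

Section Additivity.
Variables lo hi : 'I_n.
Hypothesis hi_succ : hi = lo.+1 :> nat.

Let lo_neq_hi : (lo == hi) = false.
Proof. by apply/eqP => /(congr1 val) /=; lia. Qed.

Let lower (k : 'I_n) : (k < lo)%N -> (k == lo) = false /\ (k == hi) = false.
Proof. by move=> kl; split; apply/eqP => /(congr1 val) /=; lia. Qed.

(** Unitriangularity with m = lo: the homomorphism [heis_lift a b] kills all
    basis elements below lo, so phi is invisible on the x_k with k <= lo. *)
Lemma heis_lift_lower a b :
  (a, b) = (lo, hi) \/ (a, b) = (hi, lo) ->
  forall phi : automorphism F, A_plus phi ->
  forall k : 'I_n, (k < hi)%N -> heis_lift a b (phi (x k)) = heis_lift a b (x k).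
Proof.
move=> ab phi Aphi k khi.
apply: (A_plus_unitriangular Aphi (m := lo)); last by rewrite -ltnS -hi_succ.
  exact: heis_liftM.
move=> l /lower[llo lhi]; rewrite heis_lift_gen.
by case: ab => -[-> ->]; rewrite llo lhi.
Qed.

(** Unitriangularity with m = hi: the exponent sum of x_hi is 1 in phi(x_hi). *)
Lemma heis_snd_hi (phi : automorphism F) : A_plus phi ->
  (heis_lift lo hi (phi (x hi))).1.2 = 1%R.
Proof.
move=> Aphi; pose h := heis_snd \o heis_lift lo hi.
have hM : {morph h : u v / u * v}.
  by move=> u v; rewrite /h /comp heis_liftM heis_sndM.
have h1 (k : 'I_n) : (k < hi)%N -> h (x k) = 1.
  move=> khi; rewrite /h /= heis_lift_gen; case: ifP => // _.
  by rewrite -val_eqE (ltn_eqF khi).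
have := A_plus_unitriangular Aphi hM h1 (leqnn hi).
by rewrite /h /= heis_lift_gen eq_sym lo_neq_hi eqxx => -[].
Qed.

Lemma heis_fst_hi (phi : automorphism F) : A_plus phi ->
  (heis_lift hi lo (phi (x hi))).1.1 = 1%R.
Proof.
move=> Aphi; pose h := heis_fst \o heis_lift hi lo.
have hM : {morph h : u v / u * v}.
  by move=> u v; rewrite /h /comp heis_liftM heis_fstM.
have h1 (k : 'I_n) : (k < hi)%N -> h (x k) = 1.
  move=> khi; rewrite /h /= heis_lift_gen -val_eqE (ltn_eqF khi).
  by case: ifP.
have := A_plus_unitriangular Aphi hM h1 (leqnn hi).
by rewrite /h /= heis_lift_gen eqxx => -[].
Qed.

(** The only generators that matter are d_(hi,j) and e_(hi,j).  They multiply
    phi(x_hi) by phi(x_j), whose image is that of x_j.  A new letter x_lo on the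
    right of x_hi creates no pair, and on the left it creates exactly one, as
    x_hi has exponent 1 in phi(x_hi). *)
Lemma pair_count_additive_lo_hi :
  additive_on (@de_set n) (fun phi : automorphism F => pair_count lo hi (phi (x hi))).
Proof.
apply: additive_on_gen => [|phi s Aphi]; first exact: pair_count_gen.
case=> [i [j [ji sE]]]; rewrite -[(phi * s) _]/(phi (s _)).
have [hii|nhii] := eqVneq hi i; last first.
  suff -> : s (x hi) = x hi by rewrite pair_count_gen addr0.
  by case: sE => ->; rewrite ?d_autE ?e_autE (negbTE nhii).
subst i; have low := heis_lift_lower (or_introl erefl) Aphi ji.
have jhi : (j == hi) = false by rewrite -val_eqE ltn_eqF.
case: sE => ->; rewrite ?d_autE ?e_autE eqxx autM /pair_count !heis_liftM low.
  rewrite !heis_mulE !heis_lift_gen jhi eqxx [hi == lo]eq_sym lo_neq_hi.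
  by case: ifP => _ /=; rewrite !(mulr0, addr0).
rewrite !heis_mulE /= heis_snd_hi // !heis_lift_gen jhi eqxx [hi == lo]eq_sym lo_neq_hi.
by case: ifP => _ /=; ring.
Qed.

Lemma pair_count_additive_hi_lo :
  additive_on (@de_set n) (fun phi : automorphism F => pair_count hi lo (phi (x hi))).
Proof.
apply: additive_on_gen => [|phi s Aphi]; first exact: pair_count_gen.
case=> [i [j [ji sE]]]; rewrite -[(phi * s) _]/(phi (s _)).
have [hii|nhii] := eqVneq hi i; last first.
  suff -> : s (x hi) = x hi by rewrite pair_count_gen addr0.
  by case: sE => ->; rewrite ?d_autE ?e_autE (negbTE nhii).
subst i; have low := heis_lift_lower (or_intror erefl) Aphi ji.
have jhi : (j == hi) = false by rewrite -val_eqE ltn_eqF.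
case: sE => ->; rewrite ?d_autE ?e_autE eqxx autM /pair_count !heis_liftM low.
  rewrite !heis_mulE /= heis_fst_hi // !heis_lift_gen jhi eqxx.
  by case: ifP => _ /=; ring.
rewrite !heis_mulE /= !heis_lift_gen jhi eqxx.
by case: ifP => _ /=; ring.
Qed.

End Additivity.
End PairCount.

(** * The coordinates of A_n^+ *)

Section Coordinates.
Variable n : nat.
Notation F := (free_group 'I_n).
Notation x := (@fg_gen 'I_n).
Notation m := (2 * (n - 1))%N.

(** The 2(n-1) coordinates are numbered so that k = 2j + b is attached to the
    pair (x_j, x_(j+1)), with b = 1 for the exponent of x_j on the left of
    x_(j+1), which e_(j+1,j) raises, and b = 0 for the one on the right. *)
Fact hi_subproof (k : 'I_m) : (k./2.+1 < n)%N.
Proof. by have := ltn_ord k; lia. Qed.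

Definition hi (k : 'I_m) : 'I_n := Ordinal (hi_subproof k).
Definition lo (k : 'I_m) : 'I_n := Ordinal (ltnW (hi_subproof k)).

Lemma lo_lt_hi k : (lo k < hi k)%N.
Proof. exact: ltnSn. Qed.

Definition step_gen (k : 'I_m) : automorphism F :=
  if odd k then e_aut (lo_lt_hi k) else d_aut (lo_lt_hi k).

Lemma consecutive_de_setE : @consecutive_de_set n = range step_gen.
Proof.
apply/seteqP; split=> [phi [i [j [ji [ij phiE]]]]|_ [k _ <-]]; last first.
  exists (hi k), (lo k), (lo_lt_hi k); split=> //.
  by rewrite /step_gen; case: ifP; [right|left].
have km (b : bool) : (b + j.*2 < m)%N by have := ltn_ord i; case: b; lia.
pose k b := Ordinal (km b).
have hik b : hi (k b) = i by apply: val_inj; rewrite /= half_bit_double -ij.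
have lok b : lo (k b) = j by apply: val_inj; rewrite /= half_bit_double.
have oddk b : odd (k b) = b by rewrite /= oddD odd_double addbF oddb.
case: phiE => ->; [exists (k false)|exists (k true)] => //; apply: aut_ext => w.
  by rewrite /step_gen oddk -[LHS]/(d_fun _ _ w) hik lok.
by rewrite /step_gen oddk -[LHS]/(e_fun _ _ w) hik lok.
Qed.

Lemma step_gen_generates : generated (range step_gen) = @A_plus n.
Proof. by rewrite -consecutive_de_setE; exact: consecutive_generates. Qed.

Definition coordinate (k : 'I_m) (phi : automorphism F) : int :=
  if odd k then pair_count (lo k) (hi k) (phi (x (hi k)))
  else pair_count (hi k) (lo k) (phi (x (hi k))).

Definition coordinates (phi : automorphism F) : 'rV[int]_m :=
  (\row_k coordinate k phi)%R.

Lemma coordinates_additive : additive_on (@de_set n) coordinates.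
Proof.
move=> phi psi Aphi Apsi; apply/rowP => k; rewrite !mxE /coordinate.
by case: ifP => _; [apply: pair_count_additive_lo_hi|apply: pair_count_additive_hi_lo].
Qed.

(** A consecutive generator moves only x_hi, and the new letter x_lo forms a
    pair with it in one of the two orders only. *)
Lemma coordinates_step_gen k : coordinates (step_gen k) = delta_mx 0%R k.
Proof.
apply/rowP => l; rewrite !mxE /coordinate /step_gen eqxx /=.
have hi_lo : (hi k == lo k) = false by apply/eqP => /(congr1 val) /=; lia.
have [hlk|hlk] := eqVneq (hi l) (hi k); last first.
  have -> : (l == k) = false by apply/eqP => lk; rewrite lk eqxx in hlk.
  suff -> : (if odd k then e_aut (lo_lt_hi k) else d_aut (lo_lt_hi k)) (x (hi l))
    = x (hi l) by rewrite !pair_count_gen if_same.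
  by case: ifP => _; rewrite ?d_autE ?e_autE (negbTE hlk).
have -> : lo l = lo k.
  by move: hlk => /(congr1 val) /= [lk]; apply: val_inj => /=.
have -> : (l == k) = (odd l == odd k).
  rewrite -val_eqE -[val l]odd_double_half -[val k]odd_double_half /=.
  move: hlk => /(congr1 val) /= [->]; rewrite eqn_add2r.
  by case: odd; case: odd.
rewrite hlk; case: (odd l); case: (odd k); rewrite ?d_autE ?e_autE eqxx;
  by rewrite /pair_count heis_liftM heis_mulE /= !heis_lift_gen !eqxx ?hi_lo
             1?eq_sym ?hi_lo.
Qed.

End Coordinates.

Theorem corollary2 (n : nat) (hn : (2 <= n)%N) :
  [/\ exists f : abelianization (A_plus_group n) -> 'rV[int]_(2 * (n - 1)),
        bijective f /\ {morph f : x y / (x * y)%g >-> (x + y)%R},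
      forall S : set (automorphism (free_group 'I_n)),
        generates_A_plus S -> (`I_(2 * (n - 1)) #<= S)%card
    & generates_A_plus (@consecutive_de_set n) /\
      forall S : set (automorphism (free_group 'I_n)),
        generates_A_plus S -> (@consecutive_de_set n #<= S)%card].
Proof.
have A_step k : @A_plus n (step_gen k).
  by rewrite -step_gen_generates; apply: generated_gen; exists k.
have lower_bound (S : set (automorphism (free_group 'I_n))) :
    generates_A_plus S -> (`I_(2 * (n - 1)) #<= S)%card.
  move=> SA; apply: (card_generators (L := @coordinates n)) => [|k].
    by move=> phi psi; rewrite SA; exact: coordinates_additive.
  by exists (step_gen k); rewrite ?SA // coordinates_step_gen.
split=> //; last first.
  split; first exact: consecutive_generates.
  move=> S /lower_bound; apply: card_le_trans.
  rewrite consecutive_de_setE; apply: (card_le_trans (card_image_le _ _)).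
  by rewrite -(card_le_eql card_II).
pose t k : A_plus_group n := GeneratedGroup (mem_set (A_step k)).
apply: (@abelianization_free _ _ (fun g => coordinates (gg_val g)) t) => [g h|k|g].
- by apply: coordinates_additive; exact/set_mem/gg_valP.
- exact: coordinates_step_gen.
have := generated_group_generated (@step_gen_generates n) g.
apply: generated_sub => h [k _ kh]; apply: generated_gen; exists k => //.
exact: val_inj.
Qed.
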